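(* Let $a:\mathbb{C}\to\mathbb{C}$ be smooth with $a(0)\ne0$, let $b$ be a nonzero real number, let $\eta:\mathbb{R}\to\mathbb{R}$ be smooth with $\eta^{-1}(-b^2)=I$ for some interval $I$ of positive length, and let $\theta:\mathbb{C}\to\mathbb{R}$ be smooth. Put $$r(z_1,z_2)=\left|z_1\,a(z_1)+b\,e^{i\theta(z_2)}\right|^2+\eta(|z_2|^2),$$ $\Omega=\{z\in\mathbb{C}^2: r(z)<0\}$ (a smooth domain) and $E=\{(0,z_2):\eta(|z_2|^2)=-b^2\}\subset\partial\Omega$. Let $p\in E$, and let $N_p$ and $L_p$ be the unit outward normal vector and the unit complex tangent vector at $p$, respectively. Let $f$ be holomorphic on $\Omega$ with $f\in C^\epsilon(\Omega)$ for some $\epsilon\in(0,1)$. Then there exist $\delta_p>0$ and $c>0$ such that for all $0<\beta<1$ there is a constant $C>0$ with $$|f(Q)-f(Q+hL_p)|\le C|h|^{\beta}$$ for all $Q=p-\delta N_p$ with $0<\delta\le\delta_p$ and all $h\in\mathbb{C}$ with $0<|h|<c\,\delta^{\epsilon}$.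
   Context: ''Smooth'' means $C^\infty$; it is a standing convention that $\Omega$ is a smooth domain, with defining function $r$. The vectors $N_p$ and $L_p$ are regarded as vectors in $\mathbb{C}^2$; $L_p$ is a unit vector in the maximal complex subspace of $T_p\partial\Omega$ (unique up to a unimodular complex factor). $f\in C^\epsilon(\Omega)$ means that there is a constant $K$ with $|f(z)-f(w)|\le K|z-w|^\epsilon$ for all $z,w\in\Omega$. *)

(* Defs.v *)
From Stdlib Require Import Reals.
From Coquelicot Require Import Coquelicot.
Open Scope R_scope.

(* Complex normed space; [norm] on it is the Euclidean norm
   sqrt (|z1|^2 + |z2|^2), not the maximum norm. *)
Definition C2 : NormedModule C_AbsRing :=
  prod_NormedModule C_AbsRing C_NormedModule C_NormedModule.

(* [V] is viewed as a real vector space: the parameter of the line is real. *)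
Definition dir_deriv {V : NormedModule C_AbsRing}
    (f : V -> R) (v z : V) : R :=
  Derive (fun t : R => f (plus z (scal (RtoC t) v))) 0.

(* Real differentiability class C^n.  On a finite-dimensional [V], f is C^(n+1)
   iff it is continuous and all its directional derivatives exist and are C^n. *)
Fixpoint is_Cn {V : NormedModule C_AbsRing} (n : nat) (f : V -> R) : Prop :=
  (forall z : V, continuous f z) /\
  match n with
  | O => True
  | S m => forall v : V,
      (forall z : V, ex_derive (fun t : R => f (plus z (scal (RtoC t) v))) 0) /\
      is_Cn m (dir_deriv f v)
  end.

Definition smooth {V : NormedModule C_AbsRing} (f : V -> R) : Prop :=
  forall n : nat, is_Cn n f.

Definition smooth_R (g : R -> R) : Prop :=
  forall (n : nat) (x : R), ex_derive_n g n x.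

Definition smooth_CC (a : C -> C) : Prop :=
  smooth (V := C_NormedModule) (fun z => Re (a z)) /\
  smooth (V := C_NormedModule) (fun z => Im (a z)).

Definition interval (I : R -> Prop) : Prop :=
  forall x y z : R, I x -> I y -> x <= z <= y -> I z.

(* The endpoints may be infinite, and may or may not belong to [I]. *)
Definition interval_of_positive_length (I : R -> Prop) : Prop :=
  interval I /\ exists x y : R, I x /\ I y /\ x < y.

Definition connected_set (D : C2 -> Prop) : Prop :=
  forall U V : C2 -> Prop, open U -> open V ->
    (forall z, D z -> U z \/ V z) ->
    (exists z, D z /\ U z) -> (exists z, D z /\ V z) ->
    exists z, D z /\ U z /\ V z.

Definition boundary (D : C2 -> Prop) (z : C2) : Prop :=
  forall P : C2 -> Prop, locally z P ->
    (exists w, P w /\ D w) /\ (exists w, P w /\ ~ D w).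

Definition domain (D : C2 -> Prop) : Prop :=
  open D /\ connected_set D /\ exists z, D z.

Definition defining_function (r : C2 -> R) (D : C2 -> Prop) : Prop :=
  smooth r /\
  (forall z, D z <-> r z < 0) /\
  (forall z, boundary D z <-> r z = 0) /\
  (forall z, boundary D z -> exists v : C2, dir_deriv r v z <> 0).

Definition smooth_domain (r : C2 -> R) (D : C2 -> Prop) : Prop :=
  domain D /\ defining_function r D.

(* The standard inner product of R^4. *)
Definition real_dot (v w : C2) : R :=
  Re (fst v) * Re (fst w) + Im (fst v) * Im (fst w) +
  Re (snd v) * Re (snd w) + Im (snd v) * Im (snd w).

(* The real tangent space at [p] of the hypersurface {r = 0}, i.e. ker dr_p. *)
Definition tangent (r : C2 -> R) (p v : C2) : Prop := dir_deriv r v p = 0.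

Definition unit_outward_normal (r : C2 -> R) (p N : C2) : Prop :=
  norm N = 1 /\
  (forall v : C2, tangent r p v -> real_dot N v = 0) /\
  0 < dir_deriv r N p.

(* The maximal complex subspace of the tangent space T is the intersection of
   T and iT; membership of v in iT is the same as i v in T. *)
Definition unit_complex_tangent (r : C2 -> R) (p L : C2) : Prop :=
  norm L = 1 /\ tangent r p L /\ tangent r p (scal Ci L).

(* [ex_filterdiff] over [C_AbsRing] is complex Frechet differentiability. *)
Definition holomorphic_on (D : C2 -> Prop) (f : C2 -> C) : Prop :=
  forall z : C2, D z ->
    ex_filterdiff (K := C_AbsRing) (U := C2) (V := C_NormedModule) f (locally z).

(* The condition is void for z = w, where [Rpower 0 eps] is a junk value. *)
Definition holder_on (eps : R) (D : C2 -> Prop) (f : C2 -> C) : Prop :=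
  exists K : R, forall z w : C2, D z -> D w -> z <> w ->
    Cmod (f z - f w)%C <= K * Rpower (norm (minus z w)) eps.

Definition expi (t : R) : C := (cos t, sin t).

Definition worm_r (a : C -> C) (b : R) (eta : R -> R) (theta : C -> R)
    (z : C2) : R :=
  Cmod (fst z * a (fst z) + RtoC b * expi (theta (snd z)))%C ^ 2
  + eta (Cmod (snd z) ^ 2).

Definition worm_domain (a : C -> C) (b : R) (eta : R -> R) (theta : C -> R)
    (z : C2) : Prop :=
  worm_r a b eta theta z < 0.

Definition worm_E (b : R) (eta : R -> R) (z : C2) : Prop :=
  fst z = RtoC 0 /\ eta (Cmod (snd z) ^ 2) = - b ^ 2.

(* Main.v *)
Require Import Defs.
From Stdlib Require Import Reals Lra Lia Psatz ClassicalEpsilon.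
From Coquelicot Require Import Coquelicot.
Open Scope R_scope.

(** Why the theorem holds. Write
      r(z) = |z1 a(z1)|^2 + 2 b Re (z1 a(z1) e^{-i theta(z2)}) + (eta(|z2|^2) + b^2).
    At p = (0, p2) in E the last term vanishes to infinite order: eta + b^2 is
    smooth and is zero on a nondegenerate interval containing |p2|^2, so all its
    derivatives vanish there, even if |p2|^2 is an endpoint
    ([flat_along_exceptional_set]). Hence dr_p depends on the first coordinate
    only, N = (n, 0) and L = (0, l), and with g = dr_p(N) > 0
      r (p - d N + h L) <= - (g / 2) d + B_m |h|^m      for every m.
    So, for every exponent s > 0, the disc of radius k d^s in the direction L
    around p - d N lies in the domain, with k depending on s but with a range of
    d that does not ([worm_thick_discs]). This uniformity is what allows delta_p
    and c to be chosen before beta: c is the k of the exponent eps.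

    On such discs f is holomorphic with bounded oscillation M, so the Cauchy
    estimate gives |f(Q) - f(Q + h L)| <= 4 M |h| / rho for a disc of radius
    rho and |h| < rho / 2 ([oscillation_estimate]); for larger h the same bound
    is trivial. With s = eps (1 - beta), that is rho = k d^(eps (1 - beta)),
    the constraint |h| <= d^eps gives |h|^(1 - beta) <= rho / k, hence
    |h| / rho <= |h|^beta / k ([ratio_le_power]), which is the claim.

    The one-variable Cauchy estimate must not assume that the derivative is
    continuous. It is obtained from Goursat's bisection argument, phrased for
    real fields: a plane field that is differentiable at every point with zero
    divergence has zero flux through every square ([flux_eq_0]). In logarithmic
    polar coordinates around z0 and by periodicity in the angle, the circular
    means of Re h do not change when the radius is divided by e^{2 pi}; they
    therefore equal Re h(z0) as soon as h is continuous at z0, even if h is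
    differentiable only off z0 ([mean_value_property]). Applied to the difference
    quotient of g at z0, this bounds g'(z0) ([cauchy_estimate]). *)

(** * Divergence theorem on squares without continuity of the derivatives *)

Lemma nested_intervals (x s : nat -> R) :
  (forall n, 0 <= s n) ->
  (forall n, x n <= x (S n) /\ x (S n) + s (S n) <= x n + s n) ->
  exists u, forall n, x n <= u <= x n + s n.
Proof.
  intros Hs Hx.
  assert (Hk : forall k n, x n <= x (k + n)%nat /\
            x (k + n)%nat + s (k + n)%nat <= x n + s n).
  { induction k as [|k IH]; intros n; simpl; [lra|].
    specialize (IH n). specialize (Hx (k + n)%nat). lra. }
  assert (Hmn : forall m n, x m <= x n + s n).
  { intros m n. destruct (Nat.le_ge_cases m n) as [H|H].
    - destruct (Hk (n - m)%nat m) as [H1 _].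
      replace (n - m + m)%nat with n in H1 by lia. specialize (Hs n). lra.
    - destruct (Hk (m - n)%nat n) as [_ H1].
      replace (m - n + n)%nat with m in H1 by lia. specialize (Hs m). lra. }
  destruct (completeness (fun t => exists n, t = x n)) as [u [Hub Hlub]].
  - exists (x 0%nat + s 0%nat). intros t [n ->]. apply Hmn.
  - exists (x 0%nat), 0%nat. reflexivity.
  - exists u. intros n. split.
    + apply Hub. now exists n.
    + apply Hlub. intros t [m ->]. apply Hmn.
Qed.

(** If P failed on a square it would fail on one of the four quarters, and so on
    down a nested sequence of squares shrinking to a point (u, v), against the
    local hypothesis at (u, v). The small squares of that hypothesis contain
    (u, v) but need not be centred at it: this is what makes first-order
    differentiability at the single point (u, v) sufficient later. *)
Lemma square_bisection (P : R -> R -> R -> Prop) :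
  (forall x y s, 0 < s -> P x y s -> P (x + s) y s -> P x (y + s) s ->
     P (x + s) (y + s) s -> P x y (2 * s)) ->
  (forall u v, exists d, 0 < d /\ forall x y s, 0 < s < d ->
     x <= u <= x + s -> y <= v <= y + s -> P x y s) ->
  forall x y s, 0 < s -> P x y s.
Proof.
  intros Hq Hl x y s Hs. apply NNPP. intros Hbad.
  assert (Hstep : forall q : R * R * R, exists q' : R * R * R,
    let '(x, y, s) := q in let '(x', y', s') := q' in
    0 < s -> ~ P x y s ->
      s' = s / 2 /\ ~ P x' y' s' /\
      x <= x' /\ x' + s' <= x + s /\ y <= y' /\ y' + s' <= y + s).
  { intros [[x0 y0] s0].
    destruct (classic (0 < s0 /\ ~ P x0 y0 s0)) as [[H0 Hb]|H];
      [|exists (0, 0, 0); tauto].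
    set (h := s0 / 2). assert (Hh : 0 < h) by (unfold h; lra).
    assert (E : s0 = 2 * h) by (unfold h; lra).
    destruct (classic (P x0 y0 h)) as [H1|H1];
      [|exists (x0, y0, h); intros; repeat split; auto; lra].
    destruct (classic (P (x0 + h) y0 h)) as [H2|H2];
      [|exists (x0 + h, y0, h); intros; repeat split; auto; lra].
    destruct (classic (P x0 (y0 + h) h)) as [H3|H3];
      [|exists (x0, y0 + h, h); intros; repeat split; auto; lra].
    exists (x0 + h, y0 + h, h). intros _ _. repeat split; auto; try lra.
    intros H5. apply Hb. rewrite E. now apply Hq. }
  (* [next] maps a bad square to a bad quarter; on good squares it is arbitrary. *)
  pose (next q := proj1_sig (constructive_indefinite_description _ (Hstep q))).
  pose (sq n := Nat.iter n next (x, y, s)).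
  pose (X n := fst (fst (sq n))). pose (Y n := snd (fst (sq n))).
  pose (S' n := snd (sq n)).
  assert (Hinv : forall n, S' n = s / 2 ^ n /\ ~ P (X n) (Y n) (S' n) /\
     X n <= X (S n) /\ X (S n) + S' (S n) <= X n + S' n /\
     Y n <= Y (S n) /\ Y (S n) + S' (S n) <= Y n + S' n).
  { assert (Hn : forall n, 0 < S' n -> ~ P (X n) (Y n) (S' n) ->
       S' (S n) = S' n / 2 /\ ~ P (X (S n)) (Y (S n)) (S' (S n)) /\
       X n <= X (S n) /\ X (S n) + S' (S n) <= X n + S' n /\
       Y n <= Y (S n) /\ Y (S n) + S' (S n) <= Y n + S' n).
    { intros n. unfold X, Y, S'. change (sq (S n)) with (next (sq n)).
      unfold next.
      destruct (constructive_indefinite_description _ (Hstep (sq n)))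
        as [q' Hq']; cbn [proj1_sig].
      destruct (sq n) as [[x1 y1] s1], q' as [[x2 y2] s2]. exact Hq'. }
    assert (Hb : forall n, S' n = s / 2 ^ n /\ ~ P (X n) (Y n) (S' n)).
    { induction n as [|n [IH1 IH2]].
      - split; [unfold S'; simpl; lra | exact Hbad].
      - destruct (Hn n) as (E & Hb & _); [|assumption|].
        + rewrite IH1. apply Rdiv_lt_0_compat; [lra|]. apply pow_lt; lra.
        + split; [|assumption]. rewrite E, IH1. simpl. field.
          apply pow_nonzero; lra. }
    intros n. destruct (Hb n) as [E Hb'].
    destruct (Hn n) as (_ & _ & H); [|assumption|tauto].
    rewrite E. apply Rdiv_lt_0_compat; [lra|]. apply pow_lt; lra. }
  assert (HS : forall n, 0 < S' n).
  { intros n. destruct (Hinv n) as [E _]. rewrite E.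
    apply Rdiv_lt_0_compat; [lra|]. apply pow_lt; lra. }
  destruct (nested_intervals X S') as [u Hu];
    [intros n; left; apply HS | intros n; specialize (Hinv n); tauto |].
  destruct (nested_intervals Y S') as [v Hv];
    [intros n; left; apply HS | intros n; specialize (Hinv n); tauto |].
  destruct (Hl u v) as (d & Hd & Hloc).
  destruct (pow_lt_1_zero (1 / 2)) with (y := d / s) as [n Hn].
  { rewrite Rabs_right; lra. }
  { now apply Rdiv_lt_0_compat. }
  specialize (Hn n (Nat.le_refl n)).
  destruct (Hinv n) as (E & Hb & _). apply Hb, Hloc; [|apply Hu|apply Hv].
  split; [apply HS|]. rewrite E.
  rewrite Rabs_right in Hn; [|left; apply pow_lt; lra].
  replace d with (s * (d / s)) by (field; lra).
  unfold Rdiv at 1. apply Rmult_lt_compat_l; [assumption|].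
  replace (/ 2 ^ n) with ((1 / 2) ^ n); [assumption|].
  unfold Rdiv. rewrite Rmult_1_l. now rewrite pow_inv.
Qed.

(** Outward flux of the field (U, - V) through the square with lower left corner
    (x, y) and side s. *)
Definition flux (U V : R -> R -> R) (x y s : R) : R :=
  RInt (U (x + s)) y (y + s) - RInt (U x) y (y + s) -
  (RInt (fun u => V u (y + s)) x (x + s) - RInt (fun u => V u y) x (x + s)).

Lemma differentiable_continuous_1 U x y p q :
  differentiable_pt_lim U x y p q -> continuous (fun u => U u y) x.
Proof.
  intros H. apply (ex_derive_continuous (V := R_NormedModule)).
  exists (p * 1 + q * 0). apply is_derive_Reals.
  apply (derivable_pt_lim_comp_2d U (fun t => t) (fun _ => y)); auto.
  - apply derivable_pt_lim_id.
  - apply derivable_pt_lim_const.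
Qed.

Lemma differentiable_continuous_2 U x y p q :
  differentiable_pt_lim U x y p q -> continuous (U x) y.
Proof.
  intros H. apply (ex_derive_continuous (V := R_NormedModule)).
  exists (p * 0 + q * 1). apply is_derive_Reals.
  apply (derivable_pt_lim_comp_2d U (fun _ => x) (fun t => t)); auto.
  - apply derivable_pt_lim_const.
  - apply derivable_pt_lim_id.
Qed.

Lemma RInt_increment_le (A B : R -> R) (y s k e : R) :
  0 < s -> ex_RInt A y (y + s) -> ex_RInt B y (y + s) ->
  (forall w, y <= w <= y + s -> Rabs (A w - B w - k) <= e) ->
  Rabs (RInt A y (y + s) - RInt B y (y + s) - s * k) <= s * e.
Proof.
  intros Hs HA HB H.
  assert (Hint : is_RInt (fun w => A w - B w - k) y (y + s)
    (RInt A y (y + s) - RInt B y (y + s) - s * k)).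
  { replace (s * k) with (scal (y + s - y) k)
      by (unfold scal; simpl; unfold mult; simpl; ring).
    apply (is_RInt_minus (V := R_NormedModule));
      [|apply (is_RInt_const (V := R_NormedModule))].
    apply (is_RInt_minus (V := R_NormedModule));
      now apply (RInt_correct (V := R_CompleteNormedModule)). }
  rewrite <- (is_RInt_unique _ _ _ _ Hint).
  replace (s * e) with ((y + s - y) * e) by ring.
  apply abs_RInt_le_const; [lra | eexists; exact Hint | exact H].
Qed.

(** Goursat's argument. The flux is additive under subdivision and bounded by
    4 e s^2 on small squares, because the flux of the affine approximation of the
    field is zero; bisection spreads this bound to all squares, for every e.
    The half-plane x < X is the form in which a punctured disc appears in
    logarithmic polar coordinates. *)
Lemma flux_eq_0 (U V : R -> R -> R) (X : R) :
  (forall x y, x < X -> exists p q m,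
     differentiable_pt_lim U x y p q /\ differentiable_pt_lim V x y m p) ->
  forall x y s, 0 < s -> x + s < X -> flux U V x y s = 0.
Proof.
  intros Hd.
  assert (IU : forall x y y', x < X -> ex_RInt (U x) y y').
  { intros x y y' Hx. apply (ex_RInt_continuous (V := R_CompleteNormedModule)).
    intros z _.
    destruct (Hd x z Hx) as (p & q & m & H & _).
    now apply differentiable_continuous_2 in H. }
  assert (IV : forall x x' y, x <= x' < X -> ex_RInt (fun u => V u y) x x').
  { intros x x' y Hx. apply (ex_RInt_continuous (V := R_CompleteNormedModule)).
    intros z Hz. rewrite Rmin_left, Rmax_right in Hz by lra.
    destruct (Hd z y) as (p & q & m & _ & H); [lra|].
    now apply (differentiable_continuous_1 V) in H. }
  assert (Hsmall : forall e x y s, 0 < e -> 0 < s -> x + s < X ->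
            Rabs (flux U V x y s) <= 4 * e * s ^ 2).
  { intros e x y s He Hs. revert x y s Hs.
    apply (square_bisection
      (fun x y s => x + s < X -> Rabs (flux U V x y s) <= 4 * e * s ^ 2)).
    - intros x y s Hs H1 H2 H3 H4 HX.
      specialize (H1 ltac:(lra)). specialize (H2 ltac:(lra)).
      specialize (H3 ltac:(lra)). specialize (H4 ltac:(lra)).
      replace (flux U V x y (2 * s)) with
        (flux U V x y s + flux U V (x + s) y s + flux U V x (y + s) s
         + flux U V (x + s) (y + s) s).
      + apply Rabs_le_between in H1. apply Rabs_le_between in H2.
        apply Rabs_le_between in H3. apply Rabs_le_between in H4.
        apply Rabs_le. lra.
      + unfold flux.
        replace (x + 2 * s) with (x + s + s) by ring.
        replace (y + 2 * s) with (y + s + s) by ring.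
        rewrite <- (RInt_Chasles (V := R_CompleteNormedModule)
          (U (x + s + s)) y (y + s) (y + s + s))
          by (apply IU; lra).
        rewrite <- (RInt_Chasles (V := R_CompleteNormedModule)
          (U x) y (y + s) (y + s + s))
          by (apply IU; lra).
        rewrite <- (RInt_Chasles (V := R_CompleteNormedModule)
          (fun u => V u (y + s + s)) x (x + s) (x + s + s))
          by (apply IV; lra).
        rewrite <- (RInt_Chasles (V := R_CompleteNormedModule)
          (fun u => V u y) x (x + s) (x + s + s))
          by (apply IV; lra).
        unfold plus; simpl. ring.
    (* A square containing a point with u >= X does not lie in x < X. *)
    - intros u v. destruct (Rlt_le_dec u X) as [Hu|Hu];
        [|exists 1; split; [lra|]; intros; lra].
      destruct (Hd u v Hu) as (p & q & m & HU & HV).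
      destruct (HU (mkposreal e He)) as [d1 H1].
      destruct (HV (mkposreal e He)) as [d2 H2].
      exists (Rmin d1 d2). split; [apply Rmin_pos; apply cond_pos|].
      intros x y s [Hs Hsd] Hx Hy HX.
      pose proof (Rmin_l d1 d2). pose proof (Rmin_r d1 d2).
      assert (Hm : forall a b, x <= a <= x + s -> y <= b <= y + s ->
         Rabs (U a b - U u v - (p * (a - u) + q * (b - v))) <= e * s /\
         Rabs (V a b - V u v - (m * (a - u) + p * (b - v))) <= e * s).
      { intros a b Ha Hb.
        assert (Ka : Rabs (a - u) <= s) by (apply Rabs_le; lra).
        assert (Kb : Rabs (b - v) <= s) by (apply Rabs_le; lra).
        assert (Hmx : e * Rmax (Rabs (a - u)) (Rabs (b - v)) <= e * s).
        { apply Rmult_le_compat_l; [lra|]. now apply Rmax_lub. }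
        split; (eapply Rle_trans; [|exact Hmx]).
        - apply H1; lra.
        - apply H2; lra. }
      assert (FU : Rabs (RInt (U (x + s)) y (y + s) - RInt (U x) y (y + s)
                     - s * (p * s)) <= s * (2 * (e * s))).
      { apply RInt_increment_le; [assumption|apply IU; lra|apply IU; lra|].
        intros w Hw.
        destruct (Hm (x + s) w) as [A1 _]; [lra|lra|].
        destruct (Hm x w) as [A2 _]; [lra|lra|].
        apply Rabs_le_between in A1. apply Rabs_le_between in A2.
        apply Rabs_le. nra. }
      assert (FV : Rabs (RInt (fun a => V a (y + s)) x (x + s)
                     - RInt (fun a => V a y) x (x + s)
                     - s * (p * s)) <= s * (2 * (e * s))).
      { apply (RInt_increment_le (fun a => V a (y + s)) (fun a => V a y));
          [assumption|apply IV; lra|apply IV; lra|].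
        intros w Hw.
        destruct (Hm w (y + s)) as [_ A1]; [lra|lra|].
        destruct (Hm w y) as [_ A2]; [lra|lra|].
        apply Rabs_le_between in A1. apply Rabs_le_between in A2.
        apply Rabs_le. nra. }
      unfold flux.
      apply Rabs_le_between in FU. apply Rabs_le_between in FV.
      apply Rabs_le. nra. }
  intros x y s Hs HX.
  destruct (Req_dec (flux U V x y s) 0) as [H|H]; [assumption|exfalso].
  apply Rabs_pos_lt in H.
  assert (H2 : 0 < s ^ 2) by (apply pow_lt; lra).
  specialize (Hsmall (Rabs (flux U V x y s) / (8 * s ^ 2)) x y s).
  assert (H3 : 0 < Rabs (flux U V x y s) / (8 * s ^ 2))
    by (apply Rdiv_lt_0_compat; lra).
  specialize (Hsmall H3 Hs HX).
  replace (4 * (Rabs (flux U V x y s) / (8 * s ^ 2)) * s ^ 2)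
    with (Rabs (flux U V x y s) / 2) in Hsmall by (field; lra).
  lra.
Qed.

(** * Mean value property and Cauchy estimates *)

(** Neighbourhoods are discs for the modulus, not boxes, so that errors multiply
    and compose exactly as moduli do. *)
Definition has_cderiv (g : C -> C) (z l : C) : Prop :=
  forall e, 0 < e -> exists d, 0 < d /\ forall w, Cmod (w - z)%C < d ->
    Cmod (g w - g z - l * (w - z))%C <= e * Cmod (w - z)%C.

Lemma has_cderiv_scal g z l k :
  has_cderiv g z l -> has_cderiv (fun w => (k * g w)%C) z (k * l)%C.
Proof.
  intros H e He.
  assert (Hk : 0 < Cmod k + 1) by (generalize (Cmod_ge_0 k); lra).
  destruct (H (e / (Cmod k + 1))) as (d & Hd & Hg);
    [now apply Rdiv_lt_0_compat|].
  exists d. split; [assumption|]. intros w Hw. specialize (Hg w Hw).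
  replace (k * g w - k * g z - k * l * (w - z))%C
    with (k * (g w - g z - l * (w - z)))%C by ring.
  rewrite Cmod_mult.
  apply Rle_trans with (Cmod k * (e / (Cmod k + 1) * Cmod (w - z)%C)).
  - apply Rmult_le_compat_l; [apply Cmod_ge_0 | assumption].
  - rewrite <- Rmult_assoc. apply Rmult_le_compat_r; [apply Cmod_ge_0|].
    apply Rle_trans with ((Cmod k + 1) * (e / (Cmod k + 1)));
      [|right; field; lra].
    apply Rmult_le_compat_r; [|lra]. left. now apply Rdiv_lt_0_compat.
Qed.

Lemma Cmod_le_2Rmax (z : C) : Cmod z <= 2 * Rmax (Rabs (fst z)) (Rabs (snd z)).
Proof.
  eapply Rle_trans; [apply Cmod_2Rmax|]. apply Rmult_le_compat_r.
  - eapply Rle_trans; [apply Rabs_pos | apply Rmax_l].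
  - assert (H := sqrt_le_1_alt 2 (2 * 2)). rewrite sqrt_square in H; lra.
Qed.

Lemma im_le_Cmod (z : C) : Rabs (Im z) <= Cmod z.
Proof. eapply Rle_trans; [apply Rmax_r | apply Rmax_Cmod]. Qed.

Lemma cauchy_riemann g x y l :
  has_cderiv g (x, y) l ->
  differentiable_pt_lim (fun u v => Re (g (u, v))) x y (Re l) (- Im l) /\
  differentiable_pt_lim (fun u v => Im (g (u, v))) x y (Im l) (Re l).
Proof.
  intros H.
  assert (K : forall e : posreal, exists d : posreal, forall u v,
     Rabs (u - x) < d -> Rabs (v - y) < d ->
     Cmod (g (u, v) - g (x, y) - l * ((u, v) - (x, y)))%C
       <= e * Rmax (Rabs (u - x)) (Rabs (v - y))).
  { intros [e He]; simpl. destruct (H (e / 2)) as (d & Hd & Hg); [lra|].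
    assert (Hd2 : 0 < d / 2) by lra.
    exists (mkposreal _ Hd2); simpl. intros u v Hu Hv.
    assert (Hm := Cmod_le_2Rmax ((u, v) - (x, y))%C).
    change (fst ((u, v) - (x, y))%C) with (u - x) in Hm.
    change (snd ((u, v) - (x, y))%C) with (v - y) in Hm.
    eapply Rle_trans; [apply Hg|nra].
    eapply Rle_lt_trans; [apply Hm|].
    assert (Rmax (Rabs (u - x)) (Rabs (v - y)) < d / 2)
      by now apply Rmax_lub_lt.
    lra. }
  split; intros e; destruct (K e) as [d Hd]; exists d; intros u v Hu Hv;
    (eapply Rle_trans; [|apply (Hd u v Hu Hv)]).
  - eapply Rle_trans; [|apply re_le_Cmod]. right. f_equal. unfold Re, Im. simpl. ring.
  - eapply Rle_trans; [|apply im_le_Cmod]. right. f_equal. unfold Re, Im. simpl. ring.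
Qed.

Lemma differentiable_pt_lim_mult a b :
  differentiable_pt_lim Rmult a b b a.
Proof.
  intros [e He]; simpl. exists (mkposreal e He); simpl. intros u v Hu Hv.
  replace (u * v - a * b - (b * (u - a) + a * (v - b)))
    with ((u - a) * (v - b)) by ring.
  rewrite Rabs_mult. apply Rmult_le_compat; try apply Rabs_pos; [lra|].
  apply Rmax_r.
Qed.

(** For f = exp and g = cos or sin these are the coordinates of
    z0 + e^(t + i s). *)
Lemma differentiable_pt_lim_polar (f g : R -> R) c t s f' g' :
  derivable_pt_lim f t f' -> derivable_pt_lim g s g' ->
  differentiable_pt_lim (fun u v => c + f u * g v) t s (f' * g s) (f t * g').
Proof.
  intros Hf Hg.
  assert (Hg2 : differentiable_pt_lim (fun _ v => g v) t s 0 g').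
  { intros e. destruct (differentiable_pt_lim_proj1_0 g s t g' Hg e) as [d Hd].
    exists d. intros u v Hu Hv. specialize (Hd v u Hv Hu).
    rewrite Rmax_comm.
    replace (g v - g s - (0 * (u - t) + g' * (v - s)))
      with (g v - g s - (g' * (v - s) + 0 * (u - t))) by ring.
    exact Hd. }
  assert (H := differentiable_pt_lim_comp Rmult (fun u _ => f u)
    (fun _ v => g v) t s _ _ _ _ _ _ (differentiable_pt_lim_mult _ _)
    (differentiable_pt_lim_proj1_0 f t s f' Hf) Hg2).
  intros e. destruct (H e) as [d Hd]. exists d. intros u v Hu Hv.
  specialize (Hd u v Hu Hv).
  replace (c + f u * g v - (c + f t * g s)
             - (f' * g s * (u - t) + f t * g' * (v - s)))
  with (f u * g v - f t * g s -
      ((g s * f' + f t * 0) * (u - t) + (g s * 0 + f t * g') * (v - s))) by ring.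
  exact Hd.
Qed.

Definition circle_point (z0 : C) (rho t : R) : C :=
  (Re z0 + rho * cos t, Im z0 + rho * sin t).

Lemma Cmod_circle_point z0 rho t :
  0 <= rho -> Cmod (circle_point z0 rho t - z0)%C = rho.
Proof.
  intros H. unfold Cmod, circle_point. simpl.
  replace (_ + _) with (rho ^ 2 * ((sin t)² + (cos t)²))
    by (unfold Rsqr, Re, Im; ring).
  rewrite sin2_cos2, Rmult_1_r. now apply sqrt_pow2.
Qed.

(** In coordinates z = z0 + e^(t + i s) the Cauchy-Riemann equations make
    (Re h, - Im h) a divergence-free field on the half-plane t < ln r. Through a
    square of side 2 pi the fluxes of the two sides s = 0 and s = 2 pi cancel by
    periodicity, so the circular mean at t equals the one at t - 2 pi. Iterating,
    it equals the limit at t = - infinity, given by the continuity of h at z0. *)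
Lemma mean_value_property (h : C -> C) (z0 : C) (r rho : R) :
  0 < rho < r ->
  (forall z, 0 < Cmod (z - z0)%C < r -> exists l, has_cderiv h z l) ->
  (forall e, 0 < e -> exists d, 0 < d /\ forall z, 0 < Cmod (z - z0)%C < d ->
     Cmod (h z - h z0)%C <= e) ->
  RInt (fun t => Re (h (circle_point z0 rho t))) 0 (2 * PI)
    = 2 * PI * Re (h z0) /\
  ex_RInt (fun t => Re (h (circle_point z0 rho t))) 0 (2 * PI).
Proof.
  intros Hrho Hh Hc. assert (Hpi := PI_RGT_0).
  pose (U t s := Re (h (circle_point z0 (exp t) s))).
  pose (V t s := Im (h (circle_point z0 (exp t) s))).
  assert (HUV : forall t s, t < ln r -> exists p q m,
     differentiable_pt_lim U t s p q /\ differentiable_pt_lim V t s m p).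
  { intros t s Ht.
    destruct (Hh (circle_point z0 (exp t) s)) as [l Hl].
    { rewrite Cmod_circle_point by (left; apply exp_pos).
      split; [apply exp_pos|]. rewrite <- (exp_ln r) by lra.
      now apply exp_increasing. }
    apply cauchy_riemann in Hl. destruct Hl as [H1 H2].
    assert (HX := differentiable_pt_lim_polar exp cos (Re z0) t s _ _
      (derivable_pt_lim_exp t) (derivable_pt_lim_cos s)).
    assert (HY := differentiable_pt_lim_polar exp sin (Im z0) t s _ _
      (derivable_pt_lim_exp t) (derivable_pt_lim_sin s)).
    assert (K1 := differentiable_pt_lim_comp _ _ _ _ _ _ _ _ _ _ _ H1 HX HY).
    assert (K2 := differentiable_pt_lim_comp _ _ _ _ _ _ _ _ _ _ _ H2 HX HY).
    do 3 eexists. split; [exact K1|].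
    match goal with |- differentiable_pt_lim _ _ _ _ ?p =>
      match type of K2 with differentiable_pt_lim _ _ _ _ ?p' =>
        replace p with p' by ring end end.
    exact K2. }
  assert (IU : forall t, t < ln r -> ex_RInt (U t) 0 (2 * PI)).
  { intros t Ht. apply (ex_RInt_continuous (V := R_CompleteNormedModule)).
    intros s _. destruct (HUV t s Ht) as (p & q & m & H & _).
    now apply differentiable_continuous_2 in H. }
  assert (Hstep : forall t, t < ln r ->
    RInt (U t) 0 (2 * PI) = RInt (U (t - 2 * PI)) 0 (2 * PI)).
  { intros t Ht.
    assert (H := flux_eq_0 U V (ln r) HUV (t - 2 * PI) 0 (2 * PI)).
    unfold flux in H. rewrite Rplus_0_l in H.
    replace (t - 2 * PI + 2 * PI) with t in H by ring.
    (* the two horizontal sides carry the same values of V *)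
    rewrite (RInt_ext (fun u => V u (2 * PI)) (fun u => V u 0)) in H.
    - specialize (H ltac:(lra) Ht). lra.
    - intros u _. unfold V, circle_point.
      now rewrite cos_2PI, sin_2PI, cos_0, sin_0. }
  assert (Hn : forall n, RInt (U (ln rho)) 0 (2 * PI)
     = RInt (U (ln rho - INR n * (2 * PI))) 0 (2 * PI)).
  { assert (ln rho < ln r) by now apply ln_increasing.
    induction n as [|n IH].
    - simpl. f_equal. f_equal. ring.
    - rewrite IH, Hstep, S_INR.
      + f_equal. f_equal. ring.
      + assert (0 <= INR n) by apply pos_INR. nra. }
  assert (Erho : forall t, U (ln rho) t = Re (h (circle_point z0 rho t))).
  { intros t. unfold U. now rewrite exp_ln by lra. }
  split.
  2:{ apply ex_RInt_ext with (U (ln rho)); [intros; apply Erho|].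
      apply IU. now apply ln_increasing. }
  rewrite <- (RInt_ext (U (ln rho))) by (intros; apply Erho).
  apply Rminus_diag_uniq.
  destruct (Req_dec (RInt (U (ln rho)) 0 (2 * PI) - 2 * PI * Re (h z0)) 0)
    as [E|E]; [assumption|exfalso].
  apply Rabs_pos_lt in E.
  set (D := Rabs _) in E.
  destruct (Hc (D / (4 * PI))) as (d & Hd & Hz).
  { apply Rdiv_lt_0_compat; lra. }
  (* n turns of 2 pi bring the radius below d. *)
  destruct (INR_unbounded (ln rho - ln d)) as [n Hn1].
  set (t := ln rho - INR n * (2 * PI)).
  assert (Ht : t < ln d).
  { unfold t. assert (0 <= INR n) by apply pos_INR.
    assert (2 < PI) by (generalize PI2_1; lra). nra. }
  assert (Htr : t < ln r).
  { unfold t. assert (ln rho < ln r) by now apply ln_increasing.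
    assert (0 <= INR n) by apply pos_INR. nra. }
  assert (HD : D <= 2 * PI * (D / (4 * PI))).
  { unfold D at 1. rewrite (Hn n). fold t.
    assert (K := RInt_increment_le (U t) (fun _ => 0) 0 (2 * PI) (Re (h z0))
      (D / (4 * PI))).
    rewrite Rplus_0_l, RInt_const in K.
    change (scal (2 * PI - 0) 0) with ((2 * PI - 0) * 0) in K.
    rewrite Rmult_0_r, Rminus_0_r in K. apply K.
    - lra.
    - now apply IU.
    - apply ex_RInt_const.
    - intros s _. rewrite Rminus_0_r. unfold U.
      eapply Rle_trans; [|apply (Hz (circle_point z0 (exp t) s))].
      + eapply Rle_trans; [|apply re_le_Cmod]. right. f_equal.
      + rewrite Cmod_circle_point by (left; apply exp_pos).
        split; [apply exp_pos|]. rewrite <- (exp_ln d) by assumption.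
        now apply exp_increasing. }
  replace (2 * PI * (D / (4 * PI))) with (D / 2) in HD by (field; lra).
  lra.
Qed.

(** The mean value property of the real part, applied to conj (h z0) h, whose
    value at z0 is |h z0|^2. *)
Lemma circle_bound (h : C -> C) (z0 : C) (r rho B : R) :
  0 < rho < r ->
  (forall z, 0 < Cmod (z - z0)%C < r -> exists l, has_cderiv h z l) ->
  (forall e, 0 < e -> exists d, 0 < d /\ forall z, 0 < Cmod (z - z0)%C < d ->
     Cmod (h z - h z0)%C <= e) ->
  (forall z, Cmod (z - z0)%C = rho -> Cmod (h z) <= B) ->
  Cmod (h z0) <= B.
Proof.
  intros Hrho Hh Hc HB. assert (Hpi := PI_RGT_0).
  destruct (Rle_lt_dec (Cmod (h z0)) 0) as [H0|H0].
  { apply Rle_trans with 0; [assumption|].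
    apply Rle_trans with (Cmod (h (circle_point z0 rho 0))).
    - apply Cmod_ge_0.
    - apply HB, Cmod_circle_point. lra. }
  pose (k := Cconj (h z0)).
  assert (Hk : Cmod k = Cmod (h z0)) by apply Cmod_conj.
  destruct (mean_value_property (fun z => (k * h z)%C) z0 r rho Hrho)
    as [E I].
  - intros z Hz. destruct (Hh z Hz) as [l Hl].
    exists (k * l)%C. now apply has_cderiv_scal.
  - intros e He. destruct (Hc (e / Cmod (h z0))) as (d & Hd & Hz).
    { now apply Rdiv_lt_0_compat. }
    exists d. split; [assumption|]. intros z Hzd.
    replace (k * h z - k * h z0)%C with (k * (h z - h z0))%C by ring.
    rewrite Cmod_mult, Hk.
    replace e with (Cmod (h z0) * (e / Cmod (h z0))) by (field; lra).
    apply Rmult_le_compat_l; [lra|]. now apply Hz.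
  - assert (K : Rabs (RInt (fun t => Re (k * h (circle_point z0 rho t))%C)
                   0 (2 * PI)) <= (2 * PI - 0) * (Cmod (h z0) * B)).
    { apply abs_RInt_le_const; [lra|exact I|]. intros t _.
      eapply Rle_trans; [apply re_le_Cmod|]. rewrite Cmod_mult, Hk.
      apply Rmult_le_compat_l; [lra|]. apply HB, Cmod_circle_point. lra. }
    rewrite E in K.
    replace (Re (k * h z0)%C) with (Cmod (h z0) ^ 2) in K.
    2:{ rewrite Cmod2_alt. unfold k. simpl. unfold Re, Im. ring. }
    rewrite Rabs_right in K by (apply Rle_ge; nra).
    apply Rmult_le_reg_l with (2 * PI * Cmod (h z0)); nra.
Qed.

(** With R the remainder of g and q the quotient at z, the remainder of the
    quotient is R / (w - z0) - (l - q) (w - z)^2 / ((w - z0) (z - z0)). *)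
Lemma has_cderiv_quotient g z0 l0 z l :
  z <> z0 -> has_cderiv g z l ->
  exists l', has_cderiv (fun w => if excluded_middle_informative (w = z0) then l0
                             else ((g w - g z0) / (w - z0))%C) z l'.
Proof.
  intros Hz Hg.
  assert (Hz0 : (z - z0 <> 0)%C).
  { intros E. apply Hz. replace z with (z - z0 + z0)%C by ring.
    rewrite E. ring. }
  pose (D := Cmod (z - z0)%C). assert (HD : 0 < D) by now apply Cmod_gt_0.
  pose (q := ((g z - g z0) / (z - z0))%C).
  exists ((l - q) / (z - z0))%C.
  intros e He.
  destruct (Hg (e * D / 4)) as (d & Hd & Hgz); [nra|].
  pose (B := Cmod (l - q)%C). assert (HB : 0 <= B) by apply Cmod_ge_0.
  (* D / 2 keeps w away from z0; the last bound makes the quadratic remainder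
     B |w - z|^2 / (|w - z0| D) at most e / 2 |w - z|. *)
  exists (Rmin d (Rmin (D / 2) (e * D ^ 2 / (4 * (B + 1))))).
  assert (HeD : 0 < e * D ^ 2) by (apply Rmult_lt_0_compat; [|apply pow_lt]; lra).
  split.
  { repeat apply Rmin_pos; try lra. apply Rdiv_lt_0_compat; lra. }
  intros w Hw.
  assert (Hw1 := Rlt_le_trans _ _ _ Hw (Rmin_l _ _)).
  assert (Hw' := Rlt_le_trans _ _ _ Hw (Rmin_r _ _)).
  assert (Hw2 := Rlt_le_trans _ _ _ Hw' (Rmin_l _ _)).
  assert (Hw3 := Rlt_le_trans _ _ _ Hw' (Rmin_r _ _)).
  assert (HwD : D / 2 <= Cmod (w - z0)%C).
  { assert (T := Cmod_triangle (w - z0) (z - w)).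
    replace (w - z0 + (z - w))%C with (z - z0)%C in T by ring.
    replace (z - w)%C with (- (w - z))%C in T by ring.
    rewrite Cmod_opp in T. fold D in T. lra. }
  assert (Hw0 : (w - z0 <> 0)%C) by (apply Cmod_gt_0; lra).
  destruct (excluded_middle_informative (w = z0)) as [E|_].
  { exfalso. apply Hw0. rewrite E. ring. }
  destruct (excluded_middle_informative (z = z0)) as [E|_]; [easy|].
  set (S := Cmod (w - z)%C) in *.
  replace ((g w - g z0) / (w - z0) - (g z - g z0) / (z - z0)
            - (l - q) / (z - z0) * (w - z))%C
    with ((g w - g z - l * (w - z)) / (w - z0)
            + - ((l - q) * (w - z) * (w - z) / ((w - z0) * (z - z0))))%C
    by (unfold q; field; split; assumption).
  eapply Rle_trans; [apply Cmod_triangle|].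
  rewrite Cmod_opp, !Cmod_div, !Cmod_mult;
    [|now apply Cmult_neq_0|assumption].
  fold D B S.
  assert (HS : 0 <= S) by apply Cmod_ge_0.
  set (W := Cmod (w - z0)%C) in *.
  specialize (Hgz w Hw1). fold S in Hgz.
  assert (HW : / W <= 2 / D).
  { replace (2 / D) with (/ (D / 2)) by (field; lra).
    apply Rinv_le_contravar; lra. }
  assert (HWp : 0 < / W) by (apply Rinv_0_lt_compat; lra).
  assert (P1 : Cmod (g w - g z - l * (w - z))%C / W <= e / 2 * S).
  { apply Rle_trans with ((e * D / 4 * S) * (2 / D)); [|right; field; lra].
    unfold Rdiv at 1. apply Rmult_le_compat; try lra; apply Cmod_ge_0. }
  assert (P2 : B * S * S / (W * D) <= e / 2 * S).
  { apply Rle_trans with (S * ((B + 1) * S) * (2 / D * / D)).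
    - replace (B * S * S / (W * D)) with (S * (B * S) * (/ W * / D))
        by (field; lra).
      assert (0 < / D) by now apply Rinv_0_lt_compat.
      apply Rmult_le_compat; [| |nra|].
      + apply Rmult_le_pos; nra.
      + nra.
      + apply Rmult_le_compat_r; lra.
    - apply Rle_trans with
        (S * ((B + 1) * (e * D ^ 2 / (4 * (B + 1)))) * (2 / D * / D));
        [|right; field; lra].
      apply Rmult_le_compat_r.
      + assert (0 < / D) by now apply Rinv_0_lt_compat. unfold Rdiv; nra.
      + apply Rmult_le_compat_l; [assumption|].
        apply Rmult_le_compat_l; lra. }
  lra.
Qed.

(** The difference quotient of g at z0, completed by l at z0, is continuous at z0,
    differentiable elsewhere, and at most M / rho on the circle of radius rho. *)
Lemma cauchy_estimate g z0 l r rho M :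
  0 < rho < r ->
  (forall z, Cmod (z - z0)%C < r -> exists l, has_cderiv g z l) ->
  has_cderiv g z0 l ->
  (forall z, Cmod (z - z0)%C < r -> Cmod (g z - g z0)%C <= M) ->
  Cmod l <= M / rho.
Proof.
  intros Hrho Hg Hl HM.
  pose (q := fun w => if excluded_middle_informative (w = z0) then l
                      else ((g w - g z0) / (w - z0))%C).
  assert (Hne : forall z, 0 < Cmod (z - z0)%C -> z <> z0).
  { intros z Hz E. apply Cmod_gt_0 in Hz. apply Hz. rewrite E. ring. }
  assert (E0 : q z0 = l).
  { unfold q. now destruct (excluded_middle_informative (z0 = z0)). }
  rewrite <- E0. apply (circle_bound q z0 r rho); [assumption| | |].
  - intros z [Hz Hzr]. destruct (Hg z Hzr) as [lz Hlz].
    apply has_cderiv_quotient with lz; auto.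
  - intros e He. destruct (Hl e He) as (d & Hd & H).
    exists d. split; [assumption|]. intros z [Hz Hzd]. rewrite E0.
    unfold q. destruct (excluded_middle_informative (z = z0)) as [E|_].
    { now apply Hne in Hz. }
    assert (Hz' := proj2 (Cmod_gt_0 _) Hz).
    replace ((g z - g z0) / (z - z0) - l)%C
      with ((g z - g z0 - l * (z - z0)) / (z - z0))%C by (field; assumption).
    rewrite Cmod_div by assumption.
    apply Rmult_le_reg_r with (Cmod (z - z0)%C); [assumption|].
    unfold Rdiv. rewrite Rmult_assoc, Rinv_l, Rmult_1_r by lra. now apply H.
  - intros z Hz. unfold q.
    destruct (excluded_middle_informative (z = z0)) as [E|_].
    { exfalso. apply (Hne z); [lra|assumption]. }
    rewrite Cmod_div by (apply Cmod_gt_0; lra). rewrite Hz.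
    apply Rmult_le_compat_r; [left; apply Rinv_0_lt_compat; lra|].
    apply HM. lra.
Qed.

(** Around each point of the segment [0, h] there is a disc of radius r / 2 inside
    the disc of radius r, so the derivative is at most 4 M / r there (Cauchy
    estimate on circles of radius r / 4). The mean value inequality for
    complex-valued g is applied to the real part of conj (g h - g 0) g. *)
Lemma oscillation_estimate (g : C -> C) r M h :
  (forall z, Cmod z < r -> exists l, has_cderiv g z l) ->
  (forall z w, Cmod z < r -> Cmod w < r -> Cmod (g z - g w)%C <= M) ->
  Cmod h < r / 2 ->
  Cmod (g h - g 0)%C <= 4 * M / r * Cmod h.
Proof.
  intros Hg HM Hh.
  assert (Hr : 0 < r) by (generalize (Cmod_ge_0 h); lra).
  assert (Hl : forall z l, Cmod z <= Cmod h -> has_cderiv g z l -> Cmod l <= 4 * M / r).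
  { intros z l Hz Hl.
    assert (T : forall w, Cmod (w - z)%C < r / 2 -> Cmod w < r).
    { intros w Hw. assert (T := Cmod_triangle (w - z) z).
      replace (w - z + z)%C with w in T by ring. lra. }
    replace (4 * M / r) with (M / (r / 4)) by (field; lra).
    apply (cauchy_estimate g z l (r / 2)); [lra| |assumption|].
    - intros w Hw. now apply Hg, T.
    - intros w Hw. apply HM; [now apply T|lra]. }
  set (D := (g h - g 0)%C).
  destruct (Rle_lt_dec (Cmod D) 0) as [H0|H0].
  { eapply Rle_trans; [exact H0|].
    assert (0 <= M).
    { eapply Rle_trans; [apply Cmod_ge_0|apply (HM h h); lra]. }
    apply Rmult_le_pos; [|apply Cmod_ge_0].
    apply Rle_mult_inv_pos; lra. }
  pose (k := Cconj D).
  pose (path (t : R) := (t * Re h, t * Im h) : C).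
  assert (Epath : forall t, path t = (RtoC t * h)%C).
  { intros t. unfold path. apply injective_projections; simpl; unfold Re, Im; ring. }
  assert (Hd : forall t, Rabs t <= 1 -> exists c,
     is_derive (fun t => Re (k * g (path t))%C) t c /\
     Rabs c <= Cmod D * (4 * M / r) * Cmod h).
  { intros t Ht.
    assert (Hp : Cmod (path t) <= Cmod h).
    { rewrite Epath, Cmod_mult, Cmod_R. generalize (Cmod_ge_0 h). nra. }
    destruct (Hg (path t)) as [l Hlt]; [lra|].
    assert (Bl := Hl _ _ Hp Hlt).
    apply (has_cderiv_scal _ _ _ k) in Hlt.
    destruct (cauchy_riemann _ _ _ _ Hlt) as [K _].
    exists (Re (k * l)%C * Re h + - Im (k * l)%C * Im h). split.
    - apply is_derive_Reals.
      apply (derivable_pt_lim_comp_2d (fun u v => Re (k * g (u, v))%C)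
        (fun t => t * Re h) (fun t => t * Im h)); [exact K| |].
      + apply is_derive_Reals. auto_derive; [trivial|ring].
      + apply is_derive_Reals. auto_derive; [trivial|ring].
    - replace (Re (k * l)%C * Re h + - Im (k * l)%C * Im h)
        with (Re (k * l * h)%C) by (simpl; unfold Re, Im; simpl; ring).
      eapply Rle_trans; [apply re_le_Cmod|].
      rewrite !Cmod_mult. unfold k. rewrite Cmod_conj.
      apply Rmult_le_compat_r; [apply Cmod_ge_0|].
      apply Rmult_le_compat_l; [lra|assumption]. }
  assert (K : Rabs (Re (k * g (path 1))%C - Re (k * g (path 0))%C)
     <= Cmod D * (4 * M / r) * Cmod h * Rabs (1 - 0)).
  { apply (bounded_variation (fun t => Re (k * g (path t))%C)
      (fun t => Derive (fun t => Re (k * g (path t))%C) t)).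
    intros t Ht. rewrite !Rminus_0_r, Rabs_R1 in Ht.
    destruct (Hd t Ht) as (c & Hc & Bc).
    pose proof (is_derive_unique (fun t : R => Re (k * g (path t))%C) t c Hc) as E.
    cbv beta. rewrite E. now split. }
  rewrite !Epath in K.
  replace (RtoC 1 * h)%C with h in K by ring.
  replace (RtoC 0 * h)%C with (RtoC 0) in K by ring.
  rewrite Rminus_0_r, Rabs_R1, Rmult_1_r in K.
  replace (Re (k * g h)%C - Re (k * g 0)%C) with (Cmod D ^ 2) in K.
  2:{ rewrite Cmod2_alt. unfold k, D. simpl. unfold Re, Im. simpl. ring. }
  rewrite Rabs_right in K by (apply Rle_ge; nra).
  apply Rmult_le_reg_l with (Cmod D); nra.
Qed.

(** * Flatness of eta along the exceptional set *)

(** At an endpoint of I the points of I approach t from one side only, which is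
    enough to compute a derivative that is known to exist. *)
Lemma Derive_n_vanish_on_interval (phi : R -> R) (I : R -> Prop) :
  smooth_R phi -> interval_of_positive_length I ->
  (forall t, I t -> phi t = 0) ->
  forall n t, I t -> Derive_n phi n t = 0.
Proof.
  intros Hs [Hint (x & y & Hx & Hy & Hxy)] H0.
  induction n as [|n IH]; intros t Ht; [now apply H0|].
  assert (Hother : exists s, I s /\ s <> t).
  { destruct (Req_dec x t) as [E|E]; [|now exists x].
    exists y. split; [assumption|lra]. }
  destruct Hother as (s & Is & Hst).
  assert (Hd := Derive_correct _ _ (Hs (S n) t)).
  change (Derive (Derive_n phi n) t) with (Derive_n phi (S n) t) in Hd.
  set (l := Derive_n phi (S n) t) in *.
  destruct (Req_dec l 0) as [E|E]; [assumption|exfalso].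
  apply Rabs_pos_lt in E.
  apply is_derive_Reals in Hd. destruct (Hd _ E) as [d Hl].
  (* The increment m (s - t) moves from t towards s, staying in I. *)
  pose (m := Rmin (1 / 2) (d / 2 / Rabs (s - t))).
  assert (Hst' : 0 < Rabs (s - t)) by (apply Rabs_pos_lt; lra).
  assert (Hd0 := cond_pos d).
  assert (Hm : 0 < m).
  { apply Rmin_pos; [lra|]. apply Rdiv_lt_0_compat; lra. }
  assert (Hm1 : m <= 1 / 2) by apply Rmin_l.
  assert (Hm2 : m * Rabs (s - t) <= d / 2).
  { replace (d / 2) with (d / 2 / Rabs (s - t) * Rabs (s - t)) by (field; lra).
    apply Rmult_le_compat_r; [lra|apply Rmin_r]. }
  specialize (Hl (m * (s - t))).
  rewrite (IH t Ht), (IH (t + m * (s - t))) in Hl.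
  - replace ((0 - 0) / (m * (s - t)) - l) with (- l) in Hl by (field; lra).
    rewrite Rabs_Ropp in Hl.
    assert (Rabs l < Rabs l); [apply Hl|lra].
    + apply Rmult_integral_contrapositive; lra.
    + rewrite Rabs_mult, (Rabs_right m) by lra. lra.
  - destruct (Rle_lt_dec s t).
    + apply (Hint s t); auto. nra.
    + apply (Hint t s); auto. nra.
Qed.

(** Induction on n, for all k at once: a bound for the derivative of order k + 1
    by |t - t0|^n gives one for order k by |t - t0|^(n+1), since the latter
    vanishes at t0. This replaces Taylor's formula and treats both sides of t0
    together. *)
Lemma flat_estimate (phi : R -> R) (t0 : R) :
  smooth_R phi -> (forall k, Derive_n phi k t0 = 0) ->
  forall n k, exists B d, 0 <= B /\ 0 < d /\
    forall t, Rabs (t - t0) <= d ->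
      Rabs (Derive_n phi k t) <= B * Rabs (t - t0) ^ n.
Proof.
  intros Hs H0. induction n as [|n IH]; intros k.
  - assert (Hc : continuous (Derive_n phi k) t0).
    { apply (ex_derive_continuous (V := R_NormedModule)). apply (Hs (S k)). }
    destruct (proj1 (filterlim_locally _ _) Hc (mkposreal 1 Rlt_0_1)) as [d Hd].
    exists 1, (d / 2). assert (Hd0 := cond_pos d).
    split; [lra|]. split; [lra|]. intros t Ht.
    assert (K : Rabs (Derive_n phi k t - Derive_n phi k t0) < 1).
    { apply (Hd t). change (Rabs (t - t0) < d). lra. }
    rewrite H0, Rminus_0_r in K. simpl. lra.
  - destruct (IH (S k)) as (B & d & HB & Hd & Hb).
    exists B, d. split; [assumption|]. split; [assumption|]. intros t Ht.
    assert (K := bounded_variation (Derive_n phi k) (Derive_n phi (S k))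
      (B * Rabs (t - t0) ^ n) t0 t).
    rewrite H0, Rminus_0_r in K. simpl.
    rewrite (Rmult_comm (Rabs (t - t0))), <- Rmult_assoc.
    apply K. intros u Hu. split.
    + apply Derive_correct. apply (Hs (S k)).
    + eapply Rle_trans; [apply Hb; lra|]. apply Rmult_le_compat_l; [assumption|].
      apply pow_incr. split; [apply Rabs_pos|assumption].
Qed.

Lemma Cmod_shift_sqr (z w : C) :
  Cmod w <= 1 ->
  Rabs (Cmod (z + w)%C ^ 2 - Cmod z ^ 2) <= (2 * Cmod z + 1) * Cmod w.
Proof.
  intros Hw.
  assert (H1 := Cmod_triangle z w).
  assert (H2 := Cmod_triangle (z + w) (- w)).
  replace (z + w + - w)%C with z in H2 by ring. rewrite Cmod_opp in H2.
  assert (Hz := Cmod_ge_0 z). assert (Hzw := Cmod_ge_0 (z + w)%C).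
  assert (Hw0 := Cmod_ge_0 w).
  apply Rabs_le. nra.
Qed.

(** r (0, p2 + w) vanishes to infinite order in w: at (0, p2) the boundary has
    contact of infinite order with the complex line z1 = 0. *)
Definition flat_at (b : R) (eta : R -> R) (p2 : C) : Prop :=
  forall n, exists B d, 0 <= B /\ 0 < d /\ forall w,
    Cmod w <= d -> Rabs (eta (Cmod (p2 + w)%C ^ 2) + b ^ 2) <= B * Cmod w ^ n.

Lemma flat_along_exceptional_set (eta : R -> R) (b : R) (I : R -> Prop) (p2 : C) :
  smooth_R eta -> interval_of_positive_length I ->
  (forall t, eta t = - b ^ 2 <-> I t) -> eta (Cmod p2 ^ 2) = - b ^ 2 ->
  flat_at b eta p2.
Proof.
  intros Hs HI Heta Hp n.
  pose (phi t := eta t + b ^ 2).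
  assert (Hphi : smooth_R phi).
  { intros k x. apply ex_derive_n_plus.
    - exists (mkposreal 1 Rlt_0_1). intros y _ j _. apply Hs.
    - exists (mkposreal 1 Rlt_0_1). intros y _ j _. apply ex_derive_n_const. }
  assert (H0 : forall k, Derive_n phi k (Cmod p2 ^ 2) = 0).
  { intros k. apply (Derive_n_vanish_on_interval phi I); auto.
    - intros t Ht. unfold phi. apply Heta in Ht. lra.
    - now apply Heta. }
  destruct (flat_estimate phi _ Hphi H0 n 0) as (B & d & HB & Hd & Hb).
  pose (m := 2 * Cmod p2 + 1).
  assert (Hm : 1 <= m) by (unfold m; generalize (Cmod_ge_0 p2); lra).
  exists (B * m ^ n), (Rmin 1 (d / m)).
  split; [apply Rmult_le_pos; [assumption|apply pow_le; lra]|].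
  split; [apply Rmin_pos; [lra|apply Rdiv_lt_0_compat; lra]|].
  intros w Hw.
  assert (Hw1 := Rle_trans _ _ _ Hw (Rmin_l _ _)).
  assert (Hw2 := Rle_trans _ _ _ Hw (Rmin_r _ _)).
  assert (K := Cmod_shift_sqr p2 w Hw1). fold m in K.
  assert (Hmd : m * Cmod w <= d).
  { replace d with (m * (d / m)) by (field; lra).
    apply Rmult_le_compat_l; lra. }
  eapply Rle_trans; [apply (Hb (Cmod (p2 + w)%C ^ 2)); lra|].
  rewrite Rmult_assoc, <- Rpow_mult_distr.
  apply Rmult_le_compat_l; [assumption|]. apply pow_incr.
  split; [apply Rabs_pos|assumption].
Qed.

(** * Geometry of the domain near E *)

Lemma exp_nondecreasing x y : x <= y -> exp x <= exp y.
Proof.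
  intros [H|H]; [left; now apply exp_increasing|right; now f_equal].
Qed.

Lemma continuous_trig_combination (T : UniformSpace) (re im cs sn : T -> R)
    (k x y : R) (z : T) :
  continuous re z -> continuous im z -> continuous cs z -> continuous sn z ->
  continuous (fun z => k * (x * (re z * cs z + im z * sn z)
                            - y * (im z * cs z - re z * sn z))) z.
Proof.
  intros Hr Hi Hc Hn.
  apply (continuous_mult (K := R_AbsRing) (fun _ => k)); [apply continuous_const|].
  apply (continuous_minus (V := R_NormedModule)).
  - apply (continuous_mult (K := R_AbsRing) (fun _ => x)); [apply continuous_const|].
    apply (continuous_plus (V := R_NormedModule));
      apply (continuous_mult (K := R_AbsRing)); assumption.
  - apply (continuous_mult (K := R_AbsRing) (fun _ => y)); [apply continuous_const|].
    apply (continuous_minus (V := R_NormedModule));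
      apply (continuous_mult (K := R_AbsRing)); assumption.
Qed.

(** The factor of t in the expansion of r (t v, z2), t real ([worm_r_expand]); at
    a flat point (0, p2) it is the differential of r on the vectors with first
    coordinate v ([worm_dir_deriv]). *)
Definition linear_part (a : C -> C) (b : R) (theta : C -> R) (z : C2) (v : C) : R :=
  2 * b * Re (v * (a (fst z) * Cconj (expi (theta (snd z)))))%C.

Lemma worm_r_expand a b eta theta (t : R) (v z2 : C) :
  worm_r a b eta theta ((RtoC t * v)%C, z2) =
  t * linear_part a b theta ((RtoC t * v)%C, z2) v
  + t ^ 2 * (Cmod v ^ 2 * Cmod (a (RtoC t * v)%C) ^ 2)
  + (eta (Cmod z2 ^ 2) + b ^ 2).
Proof.
  unfold worm_r, linear_part. simpl fst. simpl snd.
  set (A := a (RtoC t * v)%C).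
  assert (E := sin2_cos2 (theta z2)). unfold Rsqr in E.
  rewrite !Cmod2_alt. unfold expi, Re, Im. destruct v as [v1 v2], A as [A1 A2].
  simpl. generalize dependent (sin (theta z2)).
  generalize (cos (theta z2)). intros c s E.
  replace (b * (b * 1)) with (b * b * (s * s + c * c)) by (rewrite E; ring).
  ring.
Qed.

Lemma linear_part_continuous a b theta (v : C) (z : C2) :
  smooth_CC a -> smooth (V := C_NormedModule) theta ->
  continuous (fun z => linear_part a b theta z v) z.
Proof.
  intros [Har Hai] Hth.
  assert (C1 := proj1 (Har 0%nat)). assert (C2' := proj1 (Hai 0%nat)).
  assert (C3 := proj1 (Hth 0%nat)).
  apply continuous_ext with (fun z : C2 => 2 * b *
    (Re v * (Re (a (fst z)) * cos (theta (snd z))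
             + Im (a (fst z)) * sin (theta (snd z)))
     - Im v * (Im (a (fst z)) * cos (theta (snd z))
               - Re (a (fst z)) * sin (theta (snd z))))).
  { intros y. unfold linear_part, expi. simpl. unfold Re, Im. simpl. ring. }
  assert (K1 : continuous (fun z : C2 => Re (a (fst z))) z).
  { apply (continuous_comp (fun z : C2 => fst z)
      (fun w : C_NormedModule => Re (a w))); [|apply C1].
    destruct z. apply (continuous_fst (U := C_UniformSpace) (V := C_UniformSpace)). }
  assert (K2 : continuous (fun z : C2 => Im (a (fst z))) z).
  { apply (continuous_comp (fun z : C2 => fst z)
      (fun w : C_NormedModule => Im (a w))); [|apply C2'].
    destruct z. apply (continuous_fst (U := C_UniformSpace) (V := C_UniformSpace)). }
  assert (K3 : continuous (fun z : C2 => theta (snd z)) z).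
  { apply (continuous_comp (fun z : C2 => snd z) theta); [|apply C3].
    destruct z. apply (continuous_snd (U := C_UniformSpace) (V := C_UniformSpace)). }
  assert (K4 : continuous (fun z : C2 => cos (theta (snd z))) z).
  { apply (continuous_comp (fun z : C2 => theta (snd z)) cos); [exact K3|].
    apply continuous_cos. }
  assert (K5 : continuous (fun z : C2 => sin (theta (snd z))) z).
  { apply (continuous_comp (fun z : C2 => theta (snd z)) sin); [exact K3|].
    apply continuous_sin. }
  exact (continuous_trig_combination C2 _ _ _ _ _ _ _ _ K1 K2 K4 K5).
Qed.

Lemma Cmod_sqr_locally_bounded (a : C -> C) :
  smooth_CC a ->
  exists M d, 0 < d /\ 0 <= M /\ forall z, Cmod z < d -> Cmod (a z) ^ 2 <= M.
Proof.
  intros [Har Hai].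
  assert (C1 := proj1 (Har 0%nat) (RtoC 0)).
  assert (C2' := proj1 (Hai 0%nat) (RtoC 0)).
  destruct (proj1 (filterlim_locally _ _) C1 (mkposreal 1 Rlt_0_1)) as [d1 H1].
  destruct (proj1 (filterlim_locally _ _) C2' (mkposreal 1 Rlt_0_1)) as [d2 H2].
  set (A := a (RtoC 0)) in *.
  exists ((Rabs (Re A) + 1) ^ 2 + (Rabs (Im A) + 1) ^ 2), (Rmin d1 d2).
  split; [apply Rmin_pos; apply cond_pos|].
  split; [apply Rplus_le_le_0_compat; apply pow2_ge_0|]. intros z Hz.
  assert (B : forall d : posreal, Cmod z < d ->
    ball (M := C_UniformSpace) (RtoC 0) d z).
  { intros d Hd. apply (norm_compat1 (V := C_NormedModule)).
    change (Cmod (z - RtoC 0)%C < d).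
    now replace (z - RtoC 0)%C with z by ring. }
  assert (E1 : Rabs (Re (a z) - Re A) < 1).
  { apply (H1 z), B. eapply Rlt_le_trans; [exact Hz|apply Rmin_l]. }
  assert (E2 : Rabs (Im (a z) - Im A) < 1).
  { apply (H2 z), B. eapply Rlt_le_trans; [exact Hz|apply Rmin_r]. }
  rewrite Cmod2_alt.
  assert (Rabs (Re (a z)) <= Rabs (Re A) + 1).
  { replace (Re (a z)) with (Re A + (Re (a z) - Re A)) by ring.
    eapply Rle_trans; [apply Rabs_triang|lra]. }
  assert (Rabs (Im (a z)) <= Rabs (Im A) + 1).
  { replace (Im (a z)) with (Im A + (Im (a z) - Im A)) by ring.
    eapply Rle_trans; [apply Rabs_triang|lra]. }
  rewrite <- (pow2_abs (Re (a z))), <- (pow2_abs (Im (a z))).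
  apply Rplus_le_compat; apply pow_incr; split; auto using Rabs_pos.
Qed.

(** The term linear in t carries the explicit factor t, so its coefficient, which
    is continuous, has merely to be close to its value at (0, p2). The shift w in
    the second variable is independent of t, so that the estimate serves both for
    the differential of r at p and for points p - d N + h L with |h| much larger
    than d. *)
Lemma worm_r_first_order a b eta theta (v p2 : C) :
  smooth_CC a -> smooth (V := C_NormedModule) theta ->
  forall e, 0 < e -> exists d, 0 < d /\ forall t w,
    Rabs t <= d -> Cmod w <= d ->
    Rabs (worm_r a b eta theta ((RtoC t * v)%C, (p2 + w)%C)
          - t * linear_part a b theta (RtoC 0, p2) v
          - (eta (Cmod (p2 + w)%C ^ 2) + b ^ 2)) <= e * Rabs t.
Proof.
  intros Ha Hth e He.
  destruct (Cmod_sqr_locally_bounded a Ha) as (M & d1 & Hd1 & HM & Hb).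
  assert (He2 : 0 < e / 2) by lra.
  destruct (proj1 (filterlim_locally _ _)
    (linear_part_continuous a b theta v (RtoC 0, p2) Ha Hth)
    (mkposreal _ He2)) as [d2 H2].
  assert (Hd2 := cond_pos d2).
  pose (V := Cmod v + 1).
  assert (HV : 0 <= Cmod v) by apply Cmod_ge_0.
  pose (m := Rmin d1 d2).
  assert (Hm : 0 < m) by now apply Rmin_pos.
  assert (Hm1 : m <= d1) by apply Rmin_l.
  assert (Hm2 : m <= d2) by apply Rmin_r.
  assert (HVM : 0 <= V ^ 2 * M) by (apply Rmult_le_pos; [apply pow2_ge_0|assumption]).
  exists (Rmin (m / 2) (Rmin (m / (2 * V)) (e / (2 * (V ^ 2 * M + 1))))).
  split.
  { repeat apply Rmin_pos; try lra; apply Rdiv_lt_0_compat; unfold V in *; lra. }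
  intros t w Ht Hw.
  assert (Hw1 := Rle_trans _ _ _ Hw (Rmin_l _ _)).
  assert (Ht' := Rle_trans _ _ _ Ht (Rmin_r _ _)).
  assert (Ht1 := Rle_trans _ _ _ Ht' (Rmin_l _ _)).
  assert (Ht2 := Rle_trans _ _ _ Ht' (Rmin_r _ _)).
  assert (Htv : Cmod (RtoC t * v)%C < m).
  { rewrite Cmod_mult, Cmod_R.
    apply Rle_lt_trans with (m / (2 * V) * V).
    - apply Rmult_le_compat; [apply Rabs_pos|assumption|assumption|unfold V; lra].
    - replace (m / (2 * V) * V) with (m / 2) by (field; unfold V; lra). lra. }
  rewrite worm_r_expand.
  assert (K1 : Rabs (linear_part a b theta ((RtoC t * v)%C, (p2 + w)%C) v
                     - linear_part a b theta (RtoC 0, p2) v) < e / 2).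
  { apply (H2 ((RtoC t * v)%C, (p2 + w)%C)). split; simpl.
    - apply (norm_compat1 (V := C_NormedModule)).
      change (Cmod (RtoC t * v - RtoC 0)%C < d2).
      replace (RtoC t * v - RtoC 0)%C with (RtoC t * v)%C by ring. lra.
    - apply (norm_compat1 (V := C_NormedModule)).
      change (Cmod (p2 + w - p2)%C < d2).
      replace (p2 + w - p2)%C with w by ring. lra. }
  specialize (Hb (RtoC t * v)%C).
  assert (K2 : Cmod v ^ 2 * Cmod (a (RtoC t * v)%C) ^ 2 <= V ^ 2 * M).
  { apply Rmult_le_compat; try apply pow2_ge_0; [|apply Hb; lra].
    apply pow_incr. unfold V. lra. }
  assert (K3 : 0 <= Cmod v ^ 2 * Cmod (a (RtoC t * v)%C) ^ 2)
    by (apply Rmult_le_pos; apply pow2_ge_0).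
  set (T := Cmod v ^ 2 * Cmod (a (RtoC t * v)%C) ^ 2) in *.
  set (l0 := linear_part a b theta (RtoC 0, p2) v) in *.
  set (l1 := linear_part a b theta ((RtoC t * v)%C, (p2 + w)%C) v) in *.
  replace (t * l1 + t ^ 2 * T + (eta (Cmod (p2 + w)%C ^ 2) + b ^ 2)
           - t * l0 - (eta (Cmod (p2 + w)%C ^ 2) + b ^ 2))
    with (((l1 - l0) + t * T) * t) by ring.
  rewrite Rabs_mult. apply Rmult_le_compat_r; [apply Rabs_pos|].
  eapply Rle_trans; [apply Rabs_triang|].
  assert (K4 : Rabs (t * T) <= e / 2).
  { rewrite Rabs_mult, (Rabs_right T) by lra.
    apply Rle_trans with (e / (2 * (V ^ 2 * M + 1)) * (V ^ 2 * M + 1)).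
    - apply Rmult_le_compat; try lra. apply Rabs_pos.
    - right. field. lra. }
  lra.
Qed.

(** By flatness of order 2 the second coordinate of the direction contributes
    nothing: this identifies the normal and the complex tangent at p. *)
Lemma worm_dir_deriv a b eta theta (p2 : C) (v : C2) :
  smooth_CC a -> smooth (V := C_NormedModule) theta ->
  flat_at b eta p2 ->
  dir_deriv (worm_r a b eta theta) v (RtoC 0, p2)
  = linear_part a b theta (RtoC 0, p2) (fst v).
Proof.
  intros ha htheta hflat. destruct v as [v1 v2]. unfold dir_deriv. simpl fst.
  set (l := linear_part a b theta (RtoC 0, p2) v1).
  apply is_derive_unique.
  apply is_derive_ext with
    (fun t => worm_r a b eta theta ((RtoC t * v1)%C, (p2 + RtoC t * v2)%C)).
  { intros t. f_equal. apply injective_projections; [|reflexivity].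
    change ((RtoC t * v1)%C = (RtoC 0 + RtoC t * v1)%C). ring. }
  apply is_derive_Reals. intros e He.
  destruct (worm_r_first_order a b eta theta v1 p2 ha htheta (e / 4))
    as (d1 & Hd1 & H1); [lra|].
  destruct (hflat 2%nat) as (B & d2 & HB & Hd2 & H2).
  pose (V := Cmod v2 + 1).
  assert (HV : 0 <= Cmod v2) by apply Cmod_ge_0.
  assert (HBV : 0 <= B * V ^ 2) by (apply Rmult_le_pos; [assumption|apply pow2_ge_0]).
  pose (m := Rmin d1 d2).
  assert (Hm : 0 < m) by now apply Rmin_pos.
  assert (Hm1 : m <= d1) by apply Rmin_l.
  assert (Hm2 : m <= d2) by apply Rmin_r.
  pose (D := Rmin (m / V) (e / (4 * (B * V ^ 2 + 1)))).
  assert (HD : 0 < D).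
  { apply Rmin_pos; apply Rdiv_lt_0_compat; unfold V; try lra. fold V. lra. }
  exists (mkposreal D HD). simpl. intros h Hh0 Hh.
  assert (Hh1 := Rlt_le_trans _ _ _ Hh (Rmin_l _ _)).
  assert (Hh2 := Rlt_le_trans _ _ _ Hh (Rmin_r _ _)).
  assert (Hha : 0 <= Rabs h) by apply Rabs_pos.
  assert (HhV : Rabs h * V <= m).
  { apply Rle_trans with (m / V * V).
    - apply Rmult_le_compat_r; [unfold V; lra|lra].
    - right. field. unfold V. lra. }
  assert (Hhm : Rabs h <= m) by (unfold V in *; nra).
  assert (Hw : Cmod (RtoC h * v2)%C <= Rabs h * V).
  { rewrite Cmod_mult, Cmod_R. apply Rmult_le_compat_l; [assumption|unfold V; lra]. }
  assert (E0 : worm_r a b eta theta ((RtoC 0 * v1)%C, (p2 + RtoC 0 * v2)%C) = 0).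
  { assert (K1 := H1 0 (RtoC 0 * v2)%C). assert (K2 := H2 (RtoC 0 * v2)%C).
    assert (Z : Cmod (RtoC 0 * v2)%C = 0) by now rewrite Cmult_0_l, Cmod_0.
    rewrite Z, Rabs_R0 in K1. rewrite Z in K2.
    specialize (K1 ltac:(lra) ltac:(lra)). specialize (K2 ltac:(lra)).
    replace (B * 0 ^ 2) with 0 in K2 by ring.
    apply Rabs_le_between in K1. apply Rabs_le_between in K2. lra. }
  rewrite Rplus_0_l, E0, Rminus_0_r.
  specialize (H1 h (RtoC h * v2)%C ltac:(lra) ltac:(lra)).
  specialize (H2 (RtoC h * v2)%C ltac:(lra)).
  fold l in H1.
  set (r := worm_r _ _ _ _ _) in *. set (phi := eta _ + b ^ 2) in *.
  assert (Hphi : Rabs phi <= e / 4 * Rabs h).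
  { eapply Rle_trans; [exact H2|].
    apply Rle_trans with (B * (Rabs h * V) ^ 2).
    - apply Rmult_le_compat_l; [assumption|]. apply pow_incr.
      split; [apply Cmod_ge_0|assumption].
    - replace (B * (Rabs h * V) ^ 2) with (B * V ^ 2 * Rabs h * Rabs h) by ring.
      apply Rmult_le_compat_r; [assumption|].
      apply Rle_trans with ((B * V ^ 2 + 1) * (e / (4 * (B * V ^ 2 + 1)))).
      + apply Rmult_le_compat; lra.
      + right. field. lra. }
  assert (Hh0' : 0 < Rabs h) by now apply Rabs_pos_lt.
  replace (r / h - l) with ((r - h * l) / h) by (field; assumption).
  rewrite Rabs_div by assumption.
  apply Rmult_lt_reg_r with (Rabs h); [assumption|].
  unfold Rdiv. rewrite Rmult_assoc, Rinv_l, Rmult_1_r by lra.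
  replace (r - h * l) with ((r - h * l - phi) + phi) by ring.
  eapply Rle_lt_trans; [apply Rabs_triang|]. nra.
Qed.

(** If m > 1/s then |h|^m <= (k d^s)^m <= k d, so the flat term is beaten by
    the linear term - (g / 2) d once k is small. The bound d0 comes from the
    first-order estimate alone, hence does not depend on s. *)
Lemma worm_thick_discs a b eta theta (p2 n l : C) :
  smooth_CC a -> smooth (V := C_NormedModule) theta ->
  flat_at b eta p2 ->
  0 < linear_part a b theta (RtoC 0, p2) n -> Cmod l <= 1 ->
  exists d0, 0 < d0 <= 1 /\ forall s, 0 < s -> exists k, 0 < k <= 1 /\
    forall d h, 0 < d <= d0 -> Cmod h <= k * Rpower d s ->
      worm_domain a b eta theta ((RtoC (- d) * n)%C, (p2 + h * l)%C).
Proof.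
  intros ha htheta hflat. set (g := linear_part a b theta (RtoC 0, p2) n).
  intros Hg Hl.
  destruct (worm_r_first_order a b eta theta n p2 ha htheta (g / 2))
    as (d1 & Hd1 & H1); [lra|].
  fold g in H1.
  exists (Rmin 1 d1).
  split; [split; [apply Rmin_pos; lra|apply Rmin_l]|]. intros s Hs.
  (* The exponent S m satisfies s (S m) >= 1. *)
  destruct (INR_unbounded (/ s)) as [m Hm].
  destruct (hflat (S m)) as (B & d2 & HB & Hd2 & H2).
  pose (k := Rmin (Rmin 1 (g / (4 * (B + 1)))) (Rmin d1 d2)).
  assert (Hk : 0 < k).
  { repeat apply Rmin_pos; try lra. apply Rdiv_lt_0_compat; lra. }
  assert (Hk1 : k <= 1) by (eapply Rle_trans; [apply Rmin_l|apply Rmin_l]).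
  assert (Hkg : k <= g / (4 * (B + 1)))
    by (eapply Rle_trans; [apply Rmin_l|apply Rmin_r]).
  assert (Hkd1 : k <= d1) by (eapply Rle_trans; [apply Rmin_r|apply Rmin_l]).
  assert (Hkd2 : k <= d2) by (eapply Rle_trans; [apply Rmin_r|apply Rmin_r]).
  exists k. split; [lra|]. intros d h [Hd Hdd] Hh.
  assert (Hdd1 := Rle_trans _ _ _ Hdd (Rmin_l _ _)).
  assert (Hdd2 := Rle_trans _ _ _ Hdd (Rmin_r _ _)).
  assert (Hpow : 0 < Rpower d s) by apply exp_pos.
  assert (Hlnd : ln d <= 0).
  { rewrite <- ln_1. apply ln_le; lra. }
  assert (Hpow1 : Rpower d s <= 1).
  { unfold Rpower. rewrite <- exp_0. apply exp_nondecreasing. nra. }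
  assert (HpowS : Rpower d s ^ S m <= d).
  { rewrite <- Rpower_pow by assumption. rewrite Rpower_mult.
    rewrite <- (exp_ln d) at 2 by assumption. apply exp_nondecreasing.
    assert (1 <= s * INR (S m)); [|nra].
    rewrite S_INR. replace 1 with (s * / s) at 1 by (field; lra).
    apply Rmult_le_compat_l; lra. }
  assert (Hw : Cmod (h * l)%C <= k * Rpower d s).
  { rewrite Cmod_mult. eapply Rle_trans; [|exact Hh].
    rewrite <- (Rmult_1_r (Cmod h)) at 2.
    apply Rmult_le_compat_l; [apply Cmod_ge_0|assumption]. }
  assert (Hwk : Cmod (h * l)%C <= k) by nra.
  specialize (H1 (- d) (h * l)%C). rewrite Rabs_Ropp, Rabs_right in H1 by lra.
  specialize (H1 ltac:(lra) ltac:(lra)).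
  specialize (H2 (h * l)%C ltac:(lra)).
  assert (H3 : B * Cmod (h * l)%C ^ S m <= g / 4 * d).
  { apply Rle_trans with (B * (k * Rpower d s) ^ S m).
    - apply Rmult_le_compat_l; [assumption|]. apply pow_incr.
      split; [apply Cmod_ge_0|assumption].
    - rewrite Rpow_mult_distr.
      assert (Hkm : k ^ S m <= k).
      { simpl. rewrite <- (Rmult_1_r k) at 3. apply Rmult_le_compat_l; [lra|].
        rewrite <- (pow1 m). apply pow_incr. lra. }
      rewrite <- Rmult_assoc. apply Rmult_le_compat.
      + apply Rmult_le_pos; [assumption|]. apply pow_le. lra.
      + apply pow_le. lra.
      + apply Rle_trans with ((B + 1) * (g / (4 * (B + 1)))).
        * apply Rmult_le_compat; try lra. apply pow_le. lra.
        * right. field. lra.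
      + assumption. }
  unfold worm_domain. apply Rabs_le_between in H1. apply Rabs_le_between in H2. nra.
Qed.

(** v |-> v c with c nonzero is injective, and the two hypotheses say that the real
    and imaginary parts of v c vanish. *)
Lemma linear_part_eq_0 (a : C -> C) (b : R) (theta : C -> R) (z : C2) (v : C) :
  b <> 0 -> a (fst z) <> RtoC 0 ->
  linear_part a b theta z v = 0 -> linear_part a b theta z (Ci * v)%C = 0 ->
  v = RtoC 0.
Proof.
  intros Hb Ha H1 H2. unfold linear_part in *.
  set (c := (a (fst z) * Cconj (expi (theta (snd z))))%C) in *.
  assert (Hc : c <> RtoC 0).
  { apply Cmult_neq_0; [assumption|].
    apply Cmod_gt_0. rewrite Cmod_conj. apply Cmod_gt_0. intros E.
    assert (E1 : cos (theta (snd z)) = 0) by exact (f_equal fst E).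
    assert (E2 : sin (theta (snd z)) = 0) by exact (f_equal snd E).
    assert (E3 := sin2_cos2 (theta (snd z))).
    rewrite E1, E2, Rsqr_0 in E3. lra. }
  assert (E1 : Re (v * c)%C = 0) by nra.
  assert (E2 : Im (v * c)%C = 0).
  { replace (Ci * v * c)%C with (v * c * Ci)%C in H2 by ring.
    rewrite re_mult_Ci in H2. nra. }
  apply NNPP. intros Hv. apply (Cmult_neq_0 v c Hv Hc).
  apply injective_projections; assumption.
Qed.

Lemma Cmod_snd_le_norm (v : C2) : Cmod (snd v) <= norm v.
Proof.
  destruct v as [v1 v2]. simpl snd.
  eapply Rle_trans; [apply Rmax_r|].
  apply (norm_prod (U := C_NormedModule) (V := C_NormedModule) v1 v2).
Qed.

(** * The tangential estimate *)

Lemma norm_scal_unit (L : C2) (k : C) :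
  norm L = 1 -> norm (scal k L) <= Cmod k.
Proof.
  intros HL. assert (H := norm_scal (K := C_AbsRing) (V := C2) k L).
  rewrite HL, Rmult_1_r in H. exact H.
Qed.

Lemma holomorphic_slice (D : C2 -> Prop) (f : C2 -> C) (Q L : C2) (z : C) :
  holomorphic_on D f -> norm L = 1 -> D (plus Q (scal z L)) ->
  exists l, has_cderiv (fun w => f (plus Q (scal w L))) z l.
Proof.
  intros Hf HL HD. destruct (Hf _ HD) as [lf [Hlin Hdom]].
  set (p := plus Q (scal z L)) in *.
  exists (lf L). intros e He.
  destruct (Hdom p (fun P HP => HP) (mkposreal e He)) as [d Hd].
  exists d. split; [apply cond_pos|]. intros w Hw.
  assert (E : minus (plus Q (scal w L)) p = scal (w - z)%C L).
  { unfold p. apply injective_projections; simpl; unfold minus, plus, opp, scal;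
      simpl; unfold mult; simpl; ring. }
  assert (Hn : norm (scal (w - z)%C L) <= Cmod (w - z)%C).
  { now apply norm_scal_unit. }
  specialize (Hd (plus Q (scal w L))).
  assert (K : ball p d (plus Q (scal w L))).
  { apply (norm_compat1 (V := C2)). rewrite E.
    eapply Rle_lt_trans; [exact Hn|exact Hw]. }
  specialize (Hd K). simpl in Hd. rewrite E, (linear_scal lf Hlin) in Hd.
  apply Rle_trans with (e * norm (scal (w - z)%C L)).
  - eapply Rle_trans; [|exact Hd]. right.
    change (norm ?x) with (Cmod x). f_equal.
    fold p. generalize (f (plus Q (scal w L))), (f p), (lf L). intros u v l.
    unfold minus, plus, opp, scal; simpl; unfold mult; simpl. ring.
  - apply Rmult_le_compat_l; [lra|assumption].
Qed.

Lemma holder_bounded (D : C2 -> Prop) (f : C2 -> C) (eps : R) :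
  0 < eps < 1 -> holder_on eps D f ->
  exists M, 0 < M /\ forall z w, D z -> D w -> norm (minus z w) <= 2 ->
    Cmod (f z - f w)%C <= M.
Proof.
  intros Heps [K HK].
  assert (HM : 0 <= Rabs K) by apply Rabs_pos.
  exists (Rabs K * Rpower 2 eps + 1).
  assert (Hp : 0 < Rpower 2 eps) by apply exp_pos.
  assert (HKp : 0 <= Rabs K * Rpower 2 eps) by (apply Rmult_le_pos; lra).
  split; [lra|]. intros z w Hz Hw Hn.
  destruct (classic (z = w)) as [E|E].
  { rewrite E. replace (f w - f w)%C with (RtoC 0) by ring. rewrite Cmod_0. lra. }
  assert (Hpos : 0 < norm (minus z w)).
  { destruct (norm_ge_0 (minus z w)) as [H|H]; [assumption|exfalso].
    apply E. symmetry in H. apply norm_eq_zero in H.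
    apply (plus_reg_r (opp w)). rewrite plus_opp_r. exact H. }
  eapply Rle_trans; [apply HK; assumption|].
  apply Rle_trans with (Rabs K * Rpower 2 eps); [|lra].
  apply Rle_trans with (Rabs K * Rpower (norm (minus z w)) eps).
  - apply Rmult_le_compat_r; [left; apply exp_pos|apply Rle_abs].
  - apply Rmult_le_compat_l; [assumption|]. apply Rle_Rpower_l; lra.
Qed.

(** x = x^(1 - beta) x^beta, and x <= d^eps gives
    x^(1 - beta) <= d^(eps (1 - beta)). *)
Lemma ratio_le_power (x d k eps beta : R) :
  0 < x <= Rpower d eps -> 0 < k -> beta < 1 ->
  x / (k * Rpower d (eps * (1 - beta))) <= Rpower x beta / k.
Proof.
  intros Hx Hk Hbeta. set (P := Rpower d (eps * (1 - beta))).
  assert (HP : 0 < P) by apply exp_pos.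
  assert (Hxb : 0 < Rpower x beta) by apply exp_pos.
  assert (E : x = Rpower x (1 - beta) * Rpower x beta).
  { rewrite <- Rpower_plus. replace (1 - beta + beta) with 1 by ring.
    now rewrite Rpower_1. }
  assert (Hb1 : Rpower x (1 - beta) <= P).
  { unfold P. rewrite <- Rpower_mult. apply Rle_Rpower_l; lra. }
  apply Rle_trans with (P * Rpower x beta / (k * P)).
  - apply Rmult_le_compat_r.
    + left. apply Rinv_0_lt_compat, Rmult_lt_0_compat; assumption.
    + rewrite E at 1. apply Rmult_le_compat_r; lra.
  - right. field. lra.
Qed.

Theorem corollary4p13
  (a : C -> C) (b : R) (eta : R -> R) (theta : C -> R) (I : R -> Prop)
  (ha : smooth_CC a) (ha0 : a (RtoC 0) <> RtoC 0)
  (hb : b <> 0)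
  (heta : smooth_R eta)
  (hI : interval_of_positive_length I)
  (hetaI : forall t : R, eta t = - b ^ 2 <-> I t)
  (htheta : smooth (V := C_NormedModule) theta)
  (hdom : smooth_domain (worm_r a b eta theta) (worm_domain a b eta theta))
  (p N L : C2)
  (hp : worm_E b eta p)
  (hN : unit_outward_normal (worm_r a b eta theta) p N)
  (hL : unit_complex_tangent (worm_r a b eta theta) p L)
  (eps : R) (heps : 0 < eps < 1)
  (f : C2 -> C)
  (hf : holomorphic_on (worm_domain a b eta theta) f)
  (hfeps : holder_on eps (worm_domain a b eta theta) f) :
  exists delta_p c : R, 0 < delta_p /\ 0 < c /\
    forall beta : R, 0 < beta < 1 ->
      exists K : R, 0 < K /\
        forall (delta : R) (h : C),
          0 < delta <= delta_p ->
          0 < Cmod h < c * Rpower delta eps ->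
          let Q : C2 := minus p (scal (RtoC delta) N) in
          let Q' : C2 := plus Q (scal h L) in
          worm_domain a b eta theta Q /\
          worm_domain a b eta theta Q' /\
          Cmod (f Q - f Q')%C <= K * Rpower (Cmod h) beta.
Proof.
  destruct p as [p1 p2], hp as [hp1 hp2]. simpl in hp1, hp2. subst p1.
  assert (Hflat := flat_along_exceptional_set eta b I p2 heta hI hetaI hp2).
  assert (Hdir := fun v => worm_dir_deriv a b eta theta p2 v ha htheta Hflat).
  destruct hN as (HN1 & HNt & HNpos). destruct hL as (HL1 & HLt & HLit).
  unfold tangent in *. rewrite Hdir in HNpos, HLt, HLit.
  assert (Hlin0 : linear_part a b theta (RtoC 0, p2) (RtoC 0) = 0).
  { unfold linear_part. rewrite Cmult_0_l. simpl. ring. }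
  (* Every direction (0, w) is tangent, so N is orthogonal to the z2-axis. *)
  assert (HN2 : snd N = RtoC 0).
  { assert (E1 := HNt (RtoC 0, RtoC 1)). assert (E2 := HNt (RtoC 0, Ci)).
    rewrite Hdir in E1, E2. specialize (E1 Hlin0). specialize (E2 Hlin0).
    unfold real_dot, Re, Im in E1, E2. simpl in E1, E2.
    apply injective_projections; simpl; lra. }
  (* L and i L are both tangent, so the z1-component of L vanishes. *)
  assert (HL0 : fst L = RtoC 0).
  { apply (linear_part_eq_0 a b theta (RtoC 0, p2)); auto. }
  assert (HL2 : Cmod (snd L) <= 1) by (rewrite <- HL1; apply Cmod_snd_le_norm).
  destruct (worm_thick_discs a b eta theta p2 (fst N) (snd L) ha htheta
    Hflat HNpos HL2) as (d0 & [Hd0 Hd01] & Hthick).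
  destruct (Hthick eps) as (c & [Hc Hc1] & Hdisc); [lra|].
  destruct (holder_bounded _ f eps heps hfeps) as (M & HM & HfM).
  exists d0, c. split; [assumption|]. split; [assumption|].
  intros beta Hbeta.
  destruct (Hthick (eps * (1 - beta))) as (k & [Hk Hk1] & Hdisck);
    [apply Rmult_lt_0_compat; lra|].
  exists (4 * M / k).
  assert (HMk : 0 < 4 * M / k) by (apply Rdiv_lt_0_compat; lra).
  split; [assumption|]. intros d h Hd [Hh0 Hh].
  set (Q := minus ((RtoC 0, p2) : C2) (scal (RtoC d) N)).
  set (Q' := plus Q (scal h L)).
  change (worm_domain a b eta theta Q /\ worm_domain a b eta theta Q' /\
    Cmod (f Q - f Q')%C <= 4 * M / k * Rpower (Cmod h) beta).
  assert (EQ : forall w : C,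
    plus Q (scal w L) = ((RtoC (- d) * fst N)%C, (p2 + w * snd L)%C) :> C2).
  { intros w. unfold Q. destruct N as [N1 N2], L as [L1 L2]. simpl in HN2, HL0 |- *.
    subst N2 L1. rewrite RtoC_opp.
    apply injective_projections; simpl; unfold minus, plus, opp, scal;
      simpl; unfold mult; simpl; ring. }
  assert (EQ0 : plus Q (scal (RtoC 0) L) = Q).
  { change (RtoC 0) with (zero : C_Ring). now rewrite scal_zero_l, plus_zero_r. }
  assert (Hpe : 0 < Rpower d eps) by apply exp_pos.
  assert (HQ : worm_domain a b eta theta Q).
  { rewrite <- EQ0, EQ. apply Hdisc; [assumption|]. rewrite Cmod_0. nra. }
  assert (HQ' : worm_domain a b eta theta Q').
  { unfold Q'. rewrite EQ. apply Hdisc; [assumption|lra]. }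
  split; [assumption|]. split; [assumption|].
  set (s := eps * (1 - beta)) in *.
  assert (Hs : 0 < s) by (apply Rmult_lt_0_compat; lra).
  assert (Hle1 : forall x, 0 < x -> Rpower d x <= 1).
  { intros x Hx. apply Rle_trans with (Rpower 1 x).
    - apply Rle_Rpower_l; lra.
    - unfold Rpower. rewrite ln_1, Rmult_0_r, exp_0. lra. }
  assert (He1 := Hle1 eps ltac:(lra)). assert (Hs1 := Hle1 s Hs).
  set (rho := k * Rpower d s).
  assert (Hrho : 0 < rho) by (apply Rmult_lt_0_compat; [assumption|apply exp_pos]).
  assert (Hrho1 : rho <= 1).
  { assert (0 < Rpower d s) by apply exp_pos. unfold rho. nra. }
  assert (Hhd : Cmod h <= Rpower d eps) by nra.
  assert (Hhb : 0 < Rpower (Cmod h) beta) by apply exp_pos.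
  assert (Hratio : Cmod h / rho <= Rpower (Cmod h) beta / k)
    by (apply ratio_le_power; lra).
  apply Rle_trans with (4 * M * (Cmod h / rho)).
  2:{ replace (4 * M / k * Rpower (Cmod h) beta)
        with (4 * M * (Rpower (Cmod h) beta / k)) by (field; lra).
      apply Rmult_le_compat_l; lra. }
  assert (Hdist : forall w w' : C, Cmod (w - w')%C <= 2 ->
    norm (minus (plus Q (scal w L)) (plus Q (scal w' L))) <= 2).
  { intros w w' Hw.
    replace (minus (plus Q (scal w L)) (plus Q (scal w' L)))
      with (scal (w - w')%C L).
    - eapply Rle_trans; [now apply norm_scal_unit|exact Hw].
    - apply injective_projections; simpl; unfold minus, plus, opp, scal;
        simpl; unfold mult; simpl; ring. }
  (* Since c d^eps need not be below rho, h may leave the half disc; then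
     |h| / rho >= 1 / 2 and the oscillation bound M suffices. *)
  destruct (Rlt_le_dec (Cmod h) (rho / 2)) as [Hin|Hout].
  - pose (g (w : C) := f (plus Q (scal w L))).
    assert (Hdw : forall w, Cmod w < rho ->
      worm_domain a b eta theta (plus Q (scal w L))).
    { intros w Hw. rewrite EQ. apply Hdisck; [assumption|]. unfold rho in Hw. lra. }
    assert (K := oscillation_estimate g rho M h).
    change (g h) with (f Q') in K.
    replace (g 0) with (f Q) in K by (unfold g; now rewrite EQ0).
    replace (f Q - f Q')%C with (- (f Q' - f Q))%C by ring. rewrite Cmod_opp.
    replace (4 * M * (Cmod h / rho)) with (4 * M / rho * Cmod h) by (field; lra).
    apply K; [| |assumption].
    + intros z Hz. apply (holomorphic_slice (worm_domain a b eta theta)); auto.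
    + intros z w Hz Hw. apply HfM; auto. apply Hdist.
      assert (T := Cmod_triangle z (- w)). rewrite Cmod_opp in T.
      unfold Cminus. lra.
  - apply Rle_trans with M.
    + rewrite <- EQ0. apply HfM; [now rewrite EQ0|assumption|].
      apply Hdist. replace (RtoC 0 - h)%C with (- h)%C by ring.
      rewrite Cmod_opp. lra.
    + assert (1 / 2 <= Cmod h / rho); [|nra].
      apply Rmult_le_reg_r with rho; [assumption|].
      unfold Rdiv at 2. rewrite Rmult_assoc, Rinv_l; lra.
Qed.
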